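(* Let $x\in\mathbb{C}$ and let $\sqrt{9x^2-1}$ denote a fixed complex square root of $9x^2-1$. Then for every integer $n\geq 0$, $$\sum_{k=0}^n \binom{n}{k}\bigl(12x\sqrt{9x^2-1}\bigr)^{n-k} B_{n-k}\,B^*_{2k}(x) = 6xn\bigl(C_{2n-2}(x) - \sqrt{9x^2-1}\,B^*_{2n-2}(x)\bigr).$$
   Context: The Bernoulli polynomials $B_n(x)$ are defined by $\sum_{n\ge0}B_n(x)\frac{z^n}{n!}=\frac{ze^{xz}}{e^z-1}$ ($|z|<2\pi$), and $B_n=B_n(0)$ are the Bernoulli numbers (so $B_1=-1/2$). The balancing polynomials are defined by $B^*_0(x)=0$, $B^*_1(x)=1$, $B^*_n(x)=6xB^*_{n-1}(x)-B^*_{n-2}(x)$ for $n\ge2$. The Lucas-balancing polynomials are defined by $C_0(x)=1$, $C_1(x)=3x$, $C_n(x)=6xC_{n-1}(x)-C_{n-2}(x)$ for $n\ge2$. For $n=0$ the right-hand side, which carries the factor $n$, is interpreted as $0$. *)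

(* Defs.v *)
From Stdlib Require Import Reals Factorial.
From Coquelicot Require Import Coquelicot.

Open Scope C_scope.

Definition Cexp (z : C) : C :=
  RtoC (exp (Re z)) * (cos (Im z), sin (Im z)).

(* [z = 0] is left out because the right-hand side has a removable singularity
   there; the values at [0 < |z| < 2 pi] determine every [B n x]. *)
Definition is_bernoulli_polynomials (B : nat -> C -> C) : Prop :=
  forall x z : C, z <> 0 -> (Cmod z < 2 * PI)%R ->
    is_series (V := C_NormedModule)
      (fun n : nat => B n x * (z ^ n / RtoC (INR (fact n))))
      (z * Cexp (x * z) / (Cexp z - 1)).

Fixpoint balancing (n : nat) (x : C) : C :=
  match n with
  | O => 0
  | S m => match m with
           | O => 1
           | S p => 6 * x * balancing m x - balancing p x
           end
  end.

Fixpoint lucas_balancing (n : nat) (x : C) : C :=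
  match n with
  | O => 1
  | S m => match m with
           | O => 3 * x
           | S p => 6 * x * lucas_balancing m x - lucas_balancing p x
           end
  end.

(* Main.v *)
(** Comparing coefficients in [b(z) e^z = b(z) + z], where [b(z) = z / (e^z - 1)],
    gives [sum_m C(n,m) B_m = B_n + [n = 1]]; real [z] suffice for this, taking real
    and imaginary parts.  With the binomial theorem it yields
    [P(y + D) - P(y) = n D y^(n-1)] for the homogenized Bernoulli polynomial
    [P(y) = sum_k C(n,k) D^(n-k) B_(n-k) y^k].  Take [y = (3x - r)^2] and
    [D = 12xr], so that [y + D = (3x + r)^2]: by the Binet formulas
    [2 r balancing(2k) = (y + D)^k - y^k] and [lucas(m) - r balancing(m) = (3x - r)^m],
    and one divides by [2r].  When [r = 0] only the term [k = n] survives. *)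

Require Import Defs.
From Stdlib Require Import Reals Factorial Lra Lia.
From Coquelicot Require Import Coquelicot.

(** * Real and imaginary parts of complex series *)

Lemma Re_sum_n (f : nat -> C) (n : nat) :
  Re (sum_n f n) = sum_n (fun k => Re (f k)) n.
Proof.
  induction n as [|n IH].
  - now rewrite !sum_O.
  - now rewrite !sum_Sn, <- IH.
Qed.

Lemma Im_sum_n (f : nat -> C) (n : nat) :
  Im (sum_n f n) = sum_n (fun k => Im (f k)) n.
Proof.
  induction n as [|n IH].
  - now rewrite !sum_O.
  - now rewrite !sum_Sn, <- IH.
Qed.

Lemma is_series_Re (f : nat -> C) (l : C) :
  is_series (V := C_NormedModule) f l -> is_series (fun k => Re (f k)) (Re l).
Proof.
  intros H; unfold is_series in *.
  apply filterlim_ext with (fun n => Re (sum_n f n)).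
  - intros n; apply Re_sum_n.
  - apply filterlim_comp with (1 := H). destruct l as [a b].
    apply (continuous_fst (U := R_UniformSpace) (V := R_UniformSpace) a b).
Qed.

Lemma is_series_Im (f : nat -> C) (l : C) :
  is_series (V := C_NormedModule) f l -> is_series (fun k => Im (f k)) (Im l).
Proof.
  intros H; unfold is_series in *.
  apply filterlim_ext with (fun n => Im (sum_n f n)).
  - intros n; apply Im_sum_n.
  - apply filterlim_comp with (1 := H). destruct l as [a b].
    apply (continuous_snd (U := R_UniformSpace) (V := R_UniformSpace) a b).
Qed.

(** * Coefficient comparison for real power series *)

(** Beyond the radius the terms do not tend to zero. *)
Lemma CV_radius_ge_of_ex_pseries (a : nat -> R) (x : R) :
  ex_pseries a x -> Rbar_le (Rabs x) (CV_radius a).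
Proof.
  intros H; apply Rbar_not_lt_le; intros Hlt.
  apply (CV_disk_outside a x Hlt), ex_series_lim_0.
  now apply ex_pseries_R.
Qed.

Lemma CV_radius_exp (x : R) : Rbar_lt x (CV_radius (fun n => / INR (fact n))).
Proof.
  apply Rbar_lt_le_trans with (Rabs (Rabs x + 1)).
  - simpl. rewrite (Rabs_right (_ + 1)).
    + generalize (Rle_abs x); lra.
    + generalize (Rabs_pos x); lra.
  - apply CV_radius_ge_of_ex_pseries; eexists; apply is_exp_Reals.
Qed.

(* Multiplying the hypothesis by [exp t - 1] gives [a(t) exp t = a(t) + c t]. *)
Lemma PS_mult_exp_coef (a : nat -> R) (c : R)
  (ha : forall t, t <> 0 -> Rabs t < 2 -> is_pseries a t (c * t / (exp t - 1)))
  (n : nat) :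
  PS_mult a (fun n => / INR (fact n)) n = a n + (if Nat.eqb n 1 then c else 0).
Proof.
  set (E := fun n => / INR (fact n)).
  set (d := fun n => if Nat.eqb n 1 then c else 0).
  assert (hd : forall t, is_pseries d t (c * t)).
  { intros t; apply is_pseries_R.
    (* From index 1 on, every partial sum equals [c * t]. *)
    apply filterlim_ext_loc with (fun _ : nat => c * t); [|apply filterlim_const].
    exists 1%nat; intros m Hm; symmetry. rewrite sum_n_Reals.
    induction Hm as [|m Hm IH]; simpl.
    - unfold d; simpl; ring.
    - rewrite IH; destruct m; [lia|]. unfold d; simpl; ring. }
  assert (hra : Rbar_lt 0 (CV_radius a) /\ Rbar_lt 1 (CV_radius a)).
  (* Any point strictly between 1 and 2 would do: [ha] reaches up to 2, and the Cauchy product at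
     [Rabs t < 1] needs [t] strictly inside the disk of convergence. *)
  { assert (H : Rbar_le (Rabs (3/2)) (CV_radius a)).
    { apply CV_radius_ge_of_ex_pseries; eexists; apply ha; [lra|].
      rewrite Rabs_right; lra. }
    rewrite Rabs_right in H by lra.
    split; (eapply Rbar_lt_le_trans; [|exact H]); simpl; lra. }
  destruct hra as [hra0 hra1].
  assert (hsm : forall t, Rabs t < 1 -> Rbar_lt (Rabs t) (CV_radius a)).
  { intros t Ht. apply Rbar_lt_trans with 1; [exact Ht|exact hra1]. }
  assert (hl : Rabs (1/2) = 1/2) by (apply Rabs_right; lra).
  change (PS_mult a E n = PS_plus a d n).
  apply PSeries_ext_recip.
  - apply Rbar_lt_le_trans with (Rabs (1/2)); [rewrite hl; simpl; lra|].
    apply CV_radius_ge_of_ex_pseries, ex_pseries_mult.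
    + apply hsm; lra.
    + apply CV_radius_exp.
  - apply Rbar_lt_le_trans with (Rabs (1/2)); [rewrite hl; simpl; lra|].
    apply CV_radius_ge_of_ex_pseries, ex_pseries_plus.
    + apply CV_radius_inside, hsm; lra.
    + eexists; apply hd.
  - exists (mkposreal 1 Rlt_0_1); intros t Ht.
    assert (Ht1 : Rabs t < 1).
    { unfold ball in Ht; simpl in Ht; unfold AbsRing_ball, abs, minus, plus, opp in Ht.
      simpl in Ht. now rewrite Ropp_0, Rplus_0_r in Ht. }
    rewrite PSeries_mult; [|now apply hsm | apply CV_radius_exp].
    rewrite PSeries_plus; [|now apply CV_radius_inside, hsm | eexists; apply hd].
    rewrite (is_pseries_unique d t _ (hd t)).
    rewrite (is_pseries_unique E t _ (is_exp_Reals t)).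
    (* At [t = 0], which [ha] excludes, the identity holds because [exp 0 = 1]. *)
    destruct (Req_dec t 0) as [->|Ht0].
    + rewrite exp_0; ring.
    + rewrite (is_pseries_unique a t _ (ha t Ht0 ltac:(lra))).
      field. intros H.
      apply Ht0, exp_inv. rewrite exp_0; lra.
Qed.

(** * The recurrence for the Bernoulli numbers *)

Lemma Cexp_RtoC (t : R) : Cexp (RtoC t) = RtoC (exp t).
Proof.
  unfold Cexp; simpl. rewrite cos_0, sin_0.
  apply injective_projections; simpl; ring.
Qed.

(** Reality of [B m 0] is not presupposed. For real [t] the value [t / (exp t - 1)] is real, so
    [PS_mult_exp_coef] applies with [c = 1] to the real parts and with [c = 0] to the imaginary
    parts. *)
Lemma bernoulli_binomial_sum (B : nat -> C -> C) (hB : is_bernoulli_polynomials B)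
  (n : nat) :
  sum_n (fun m => RtoC (Binomial.C n m) * B m 0)%C n
  = (B n 0 + (if Nat.eqb n 1 then 1 else 0))%C.
Proof.
  assert (hser : forall t : R, t <> 0 -> Rabs t < 2 ->
    is_series (V := C_NormedModule)
      (fun n => (B n 0 * RtoC (t ^ n / INR (fact n)))%C)
      (RtoC (t / (exp t - 1)))).
  { intros t Ht0 Ht2.
    assert (He : exp t - 1 <> 0).
    { intros H; apply Ht0, exp_inv. rewrite exp_0; lra. }
    assert (H := hB 0%C (RtoC t)).
    rewrite Cmult_0_l, !Cexp_RtoC, exp_0, Cmult_1_r, <- RtoC_minus, <- RtoC_div in H.
    eapply is_series_ext; [|apply H].
    - intros k; cbv beta. rewrite <- RtoC_pow, <- RtoC_div; [reflexivity|apply INR_fact_neq_0].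
    - intros E; apply Ht0; now injection E.
    - rewrite Cmod_R. generalize PI2_1; lra.
    - assumption. }
  assert (hn : INR (fact n) <> 0) by apply INR_fact_neq_0.
  (* Since [n! / (m! (n-m)!)] is the binomial coefficient, a binomial convolution is [n!] times a
     Cauchy product coefficient. *)
  assert (hcomb : forall b : nat -> R,
    sum_n (fun m => Binomial.C n m * b m) n
    = INR (fact n) * PS_mult (fun k => b k / INR (fact k)) (fun k => / INR (fact k)) n).
  { intros b; unfold PS_mult. rewrite <- sum_n_Reals.
    etransitivity; [|apply (sum_n_mult_l (K := R_Ring))].
    apply sum_n_ext; intros m. unfold mult, Binomial.C; simpl.
    field; split; apply INR_fact_neq_0. }
  (* The correction lives at [n = 1], where the factor [n!] is 1. *)
  assert (hf : INR (fact n) * (if Nat.eqb n 1 then 1 else 0) = if Nat.eqb n 1 then 1 else 0).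
  { destruct n as [|[|n]]; simpl; ring. }
  apply injective_projections.
  - change (Re (sum_n (fun m => RtoC (Binomial.C n m) * B m 0)%C n)
            = Re (B n 0) + Re (if Nat.eqb n 1 then 1 else 0)%C).
    rewrite Re_sum_n.
    rewrite (sum_n_ext _ (fun m => Binomial.C n m * Re (B m 0))) by (intros m; simpl; unfold Re; ring).
    rewrite hcomb, (PS_mult_exp_coef _ 1).
    + rewrite Rmult_plus_distr_l, hf. replace (Re (if Nat.eqb n 1 then _ else _))
        with (if Nat.eqb n 1 then 1 else 0) by (destruct Nat.eqb; reflexivity).
      field; assumption.
    + intros t Ht0 Ht2. apply is_pseries_R. generalize (is_series_Re _ _ (hser t Ht0 Ht2)).
      simpl Re at 2. rewrite Rmult_1_l. apply is_series_ext; intros k. unfold Re; simpl.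
      field; apply INR_fact_neq_0.
  - change (Im (sum_n (fun m => RtoC (Binomial.C n m) * B m 0)%C n)
            = Im (B n 0) + Im (if Nat.eqb n 1 then 1 else 0)%C).
    rewrite Im_sum_n.
    rewrite (sum_n_ext _ (fun m => Binomial.C n m * Im (B m 0))) by (intros m; simpl; unfold Im; ring).
    rewrite hcomb, (PS_mult_exp_coef _ 0).
    + replace (Im (if Nat.eqb n 1 then _ else _)) with 0 by (destruct Nat.eqb; reflexivity).
      destruct (Nat.eqb n 1); field; assumption.
    + intros t Ht0 Ht2. apply is_pseries_R. generalize (is_series_Im _ _ (hser t Ht0 Ht2)).
      simpl Im at 2. replace (0 * t / (exp t - 1)) with 0 by (unfold Rdiv; ring).
      apply is_series_ext; intros k. unfold Im; simpl.
      field; apply INR_fact_neq_0.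
Qed.

(* [ring] and [field] do not see through the carrier projections that [sum_n] leaves in
   the type of an equation. *)
Ltac eq_in_C := match goal with |- @eq _ ?a ?b => change (@eq C a b) end.
Ltac Cring := eq_in_C; ring.

(** * Finite complex sums and the binomial theorem *)

Lemma sum_n_C_Sn (f : nat -> C) (n : nat) : sum_n f (S n) = (sum_n f n + f (S n))%C.
Proof. apply (sum_Sn (G := C_AbelianMonoid)). Qed.

Lemma sum_n_C_Sn_l (f : nat -> C) (n : nat) :
  sum_n f (S n) = (f O + sum_n (fun k => f (S k)) n)%C.
Proof.
  induction n as [|n IH].
  - now rewrite sum_n_C_Sn, !sum_O.
  - rewrite sum_n_C_Sn, IH, sum_n_C_Sn; Cring.
Qed.

Lemma sum_n_C_rev (f : nat -> C) (n : nat) :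
  sum_n (fun k => f (n - k)%nat) n = sum_n f n.
Proof.
  induction n as [|n IH].
  - now rewrite !sum_O.
  - rewrite sum_n_C_Sn_l, sum_n_C_Sn, <- IH, Nat.sub_0_r.
    cbn [Nat.sub]; Cring.
Qed.

Lemma sum_n_C_plus (f g : nat -> C) (n : nat) :
  sum_n (fun k => f k + g k)%C n = (sum_n f n + sum_n g n)%C.
Proof. apply (sum_n_plus (G := C_AbelianMonoid)). Qed.

Lemma sum_n_C_mult_l (c : C) (f : nat -> C) (n : nat) :
  sum_n (fun k => c * f k)%C n = (c * sum_n f n)%C.
Proof. apply (sum_n_mult_l (K := C_Ring)). Qed.

Lemma Cpow_plus_binomial (a b : C) (n : nat) :
  ((a + b) ^ n)%C = sum_n (fun k => RtoC (Binomial.C n k) * a ^ k * b ^ (n - k))%C n.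
Proof.
  induction n as [|n IH].
  - rewrite sum_O, C_n_0; simpl; Cring.
  (* Exponent 1 is separate: no inner terms remain there once both end terms are split off. *)
  - destruct n as [|n].
    + rewrite sum_n_C_Sn, sum_O, C_n_0, C_n_n; simpl; Cring.
    + rewrite Cpow_S, IH, Cmult_plus_distr_r, <- !sum_n_C_mult_l.
      rewrite sum_n_C_Sn. rewrite (sum_n_C_Sn_l (fun k => b * _)%C).
      rewrite (sum_n_C_Sn _ (S n)), (sum_n_C_Sn_l (fun k => _ * _ * _)%C).
      rewrite !C_n_n, !C_n_0, !Nat.sub_0_r, !Nat.sub_diag.
      (* The two end terms stand apart, because Pascal's rule covers only the inner indices. *)
      transitivity (b * b ^ S n + a * a ^ S n +
        sum_n (fun k => RtoC (Binomial.C (S (S n)) (S k)) * a ^ S k * b ^ (S (S n) - S k)) n)%C;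
        [|simpl; Cring].
      rewrite (sum_n_ext_loc (G := C_AbelianMonoid) (fun k => RtoC (Binomial.C (S (S n)) (S k)) * _ * _)%C
        (fun k => a * (RtoC (Binomial.C (S n) k) * a ^ k * b ^ (S n - k))
                  + b * (RtoC (Binomial.C (S n) (S k)) * a ^ S k * b ^ (S n - S k)))%C).
      * rewrite sum_n_C_plus; simpl; Cring.
      * intros k Hk. rewrite <- pascal by lia. rewrite RtoC_plus.
        replace (S (S n) - S k)%nat with (S (S n - S k)) by lia.
        replace (S n - k)%nat with (S (S n - S k)) by lia.
        rewrite !Cpow_S; Cring.
Qed.

(** * The difference equation *)

(** Exchange of summation over [j <= k <= n], with [k = m + j]; it serves to collect the coefficient
    of each [y ^ j]. *)
Lemma sum_n_triangle (f : nat -> nat -> C) (n : nat) :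
  sum_n (fun k => sum_n (f k) k) n
  = sum_n (fun j => sum_n (fun m => f (m + j)%nat j) (n - j)) n.
Proof.
  induction n as [|n IH].
  - now rewrite !sum_O.
  - rewrite sum_n_C_Sn, IH, (sum_n_C_Sn (f (S n))), (sum_n_C_Sn _ n), Nat.sub_diag, sum_O.
    rewrite (sum_n_ext_loc (G := C_AbelianMonoid)
      (fun j => sum_n _ (S n - j))
      (fun j => sum_n (fun m => f (m + j)%nat j) (n - j) + f (S n) j)%C n).
    + rewrite sum_n_C_plus; cbn [Nat.add]; Cring.
    + intros j Hj. replace (S n - j)%nat with (S (n - j)) by lia.
      rewrite sum_n_C_Sn. now replace (S (n - j) + j)%nat with (S n) by lia.
Qed.

(** Both products are the trinomial coefficient [n! / (m! j! (n-m-j)!)]. *)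
Lemma binomial_trinomial_revision (n m j : nat) : (m + j <= n)%nat ->
  Binomial.C n (m + j) * Binomial.C (m + j) j
  = Binomial.C n j * Binomial.C (n - j) m.
Proof.
  intros H; unfold Binomial.C.
  replace (m + j - j)%nat with m by lia.
  replace (n - j - m)%nat with (n - (m + j))%nat by lia.
  field; repeat split; apply INR_fact_neq_0.
Qed.

Lemma binomial_sub (n k : nat) : (k <= n)%nat -> Binomial.C n (n - k) = Binomial.C n k.
Proof. intros H; symmetry; now apply pascal_step1. Qed.

(* With [D = 1] this is [B_n(y + 1) - B_n(y) = n y^(n-1)]. *)
Lemma bernoulli_difference (B : nat -> C -> C) (hB : is_bernoulli_polynomials B)
  (D y : C) (n : nat) :
  sum_n (fun k => RtoC (Binomial.C n k) * D ^ (n - k) * B (n - k)%nat 0 * (y + D) ^ k)%C n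
  = (sum_n (fun k => RtoC (Binomial.C n k) * D ^ (n - k) * B (n - k)%nat 0 * y ^ k)%C n
     + RtoC (INR n) * D * y ^ (n - 1))%C.
Proof.
  rewrite (sum_n_ext (G := C_AbelianMonoid) _ (fun k => sum_n (fun j =>
    RtoC (Binomial.C n k) * D ^ (n - k) * B (n - k)%nat 0
    * (RtoC (Binomial.C k j) * y ^ j * D ^ (k - j))) k)%C).
  2: { intros k. now rewrite sum_n_C_mult_l, Cpow_plus_binomial. }
  rewrite sum_n_triangle.
  (* The coefficient of [y ^ j] contains the Bernoulli recurrence of order [n - j]; its correction
     term produces the second summand. *)
  rewrite (sum_n_ext_loc (G := C_AbelianMonoid) _ (fun j =>
      RtoC (Binomial.C n j) * D ^ (n - j) * B (n - j)%nat 0 * y ^ j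
      + RtoC (Binomial.C n j) * D ^ (n - j) * y ^ j * (if Nat.eqb (n - j) 1 then 1 else 0))%C).
  - rewrite sum_n_C_plus. f_equal.
    (* Only [j = n - 1] contributes. For [n = 0] there is no such index, and the right-hand side
       vanishes through [INR 0]. *)
    destruct n as [|[|n]].
    + rewrite sum_O; simpl; Cring.
    + rewrite sum_n_C_Sn, sum_O, C_n_0, C_n_n; simpl; Cring.
    + rewrite !sum_n_C_Sn.
      (* Writing zero as [0 * 0] lets [sum_n_C_mult_l] pull out a zero factor. *)
      rewrite (sum_n_ext_loc (G := C_AbelianMonoid) _ (fun _ => 0 * 0)%C n), sum_n_C_mult_l.
      * replace (S (S n) - S n)%nat with 1%nat by lia.
        replace (S (S n) - 1)%nat with (S n) by lia.
        rewrite Nat.sub_diag.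
        replace (Binomial.C (S (S n)) (S n)) with (INR (S (S n))).
        -- cbn [Nat.eqb]; rewrite Cpow_1_r; Cring.
        -- unfold Binomial.C. replace (S (S n) - S n)%nat with 1%nat by lia.
           rewrite (fact_simpl (S n)), mult_INR. simpl (fact 1).
           change (INR 1) with 1. field. apply INR_fact_neq_0.
      * intros k Hk. destruct (Nat.eqb_spec (S (S n) - k) 1); [lia|Cring].
  - intros j Hj.
    transitivity (RtoC (Binomial.C n j) * D ^ (n - j) * y ^ j *
      sum_n (fun m => RtoC (Binomial.C (n - j) m) * B m 0) (n - j))%C.
    2: { rewrite bernoulli_binomial_sum by assumption; Cring. }
    (* Reversal gives the Bernoulli number the index [n - j - m] that it has in the triangle sum. *)
    rewrite <- (sum_n_C_rev (fun m => RtoC _ * _)%C (n - j)).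
    rewrite <- sum_n_C_mult_l.
    apply sum_n_ext_loc; intros m Hm.
    replace (n - (m + j))%nat with (n - j - m)%nat by lia.
    rewrite binomial_sub by lia.
    replace (m + j - j)%nat with m by lia.
    transitivity (RtoC (Binomial.C n (m + j) * Binomial.C (m + j) j)
       * D ^ (n - j - m + m) * B (n - j - m)%nat 0 * y ^ j)%C.
    + rewrite RtoC_mult, Cpow_add_r; Cring.
    + rewrite binomial_trinomial_revision by lia.
      replace (n - j - m + m)%nat with (n - j)%nat by lia.
      rewrite RtoC_mult; Cring.
Qed.

(** * Binet formulas and the degenerate case *)

(** By [hr], the numbers [3x + r] and [3x - r] are the roots of [t^2 = 6xt - 1], so their powers
    obey the same recurrence. As it has order two, the induction carries two consecutive indices. *)
Lemma lucas_balancing_balancing_pow (x r : C) (hr : (r ^ 2 = 9 * x ^ 2 - 1)%C) (n : nat) :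
  (lucas_balancing n x + r * balancing n x = (3 * x + r) ^ n /\
   lucas_balancing n x - r * balancing n x = (3 * x - r) ^ n)%C.
Proof.
  assert (H : forall m,
   (lucas_balancing m x + r * balancing m x = (3 * x + r) ^ m /\
   lucas_balancing m x - r * balancing m x = (3 * x - r) ^ m /\
   lucas_balancing (S m) x + r * balancing (S m) x = (3 * x + r) ^ (S m) /\
   lucas_balancing (S m) x - r * balancing (S m) x = (3 * x - r) ^ (S m))%C).
  { induction m as [|m [H1 [H2 [H3 H4]]]].
    - simpl; repeat split; Cring.
    - do 2 (split; [assumption|]).
      change (lucas_balancing (S (S m)) x) with (6 * x * lucas_balancing (S m) x - lucas_balancing m x)%C.
      change (balancing (S (S m)) x) with (6 * x * balancing (S m) x - balancing m x)%C.
      split.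
      + transitivity (6 * x * (lucas_balancing (S m) x + r * balancing (S m) x)
          - (lucas_balancing m x + r * balancing m x))%C; [Cring|].
        rewrite H1, H3, !Cpow_S.
        transitivity ((3 * x + r) ^ m * (9 * x ^ 2 + 6 * x * r + (9 * x ^ 2 - 1)))%C; [|rewrite <- hr]; Cring.
      + transitivity (6 * x * (lucas_balancing (S m) x - r * balancing (S m) x)
          - (lucas_balancing m x - r * balancing m x))%C; [Cring|].
        rewrite H2, H4, !Cpow_S.
        transitivity ((3 * x - r) ^ m * (9 * x ^ 2 - 6 * x * r + (9 * x ^ 2 - 1)))%C; [|rewrite <- hr]; Cring. }
  split; apply H.
Qed.

(** This replaces the Binet formula when [r = 0]: the double root [3x] gives [m (3x)^(m-1)] at index
    [m], and [(3x)^2 = 1]. The odd indices are needed for the induction. *)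
Lemma balancing_even_of_sq_eq (x : C) (hx : (9 * x ^ 2 = 1)%C) (n : nat) :
  (balancing (2 * n) x = 6 * x * RtoC (INR n))%C.
Proof.
  enough (H : (balancing (2 * n) x = 6 * x * RtoC (INR n)
               /\ balancing (S (2 * n)) x = 2 * RtoC (INR n) + 1)%C) by apply H.
  induction n as [|n [IH0 IH1]].
  - simpl; split; ring.
  - replace (2 * S n)%nat with (S (S (2 * n))) by lia.
    change (balancing (S (S (S (2 * n)))) x)
      with (6 * x * balancing (S (S (2 * n))) x - balancing (S (2 * n)) x)%C.
    change (balancing (S (S (2 * n))) x)
      with (6 * x * balancing (S (2 * n)) x - balancing (2 * n) x)%C.
    rewrite IH0, IH1, S_INR, RtoC_plus. split.
    + ring.
    + transitivity (4 * (9 * x ^ 2) * (RtoC (INR n) + 1) - 2 * RtoC (INR n) - 1)%C;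
        [ring|rewrite hx; ring].
Qed.

(** The generating function is not given at [z = 0], so the value is read off from the recurrence at
    [n = 1], where [B 1 0] cancels. *)
Lemma bernoulli_0 (B : nat -> C -> C) (hB : is_bernoulli_polynomials B) : B O 0 = 1%C.
Proof.
  assert (H := bernoulli_binomial_sum B hB 1).
  rewrite sum_n_C_Sn, sum_O, C_n_0, C_n_n in H. cbn [Nat.eqb] in H.
  transitivity (1 * B O 0 + 1 * B 1%nat 0 - B 1%nat 0)%C; [Cring|].
  rewrite H; ring.
Qed.

Theorem theorem2 (B : nat -> C -> C) (hB : is_bernoulli_polynomials B)
  (x r : C) (hr : (r ^ 2 = 9 * x ^ 2 - 1)%C) (n : nat) :
  sum_n (fun k : nat =>
           RtoC (Binomial.C n k) * (12 * x * r) ^ (n - k)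
           * B (n - k)%nat 0 * balancing (2 * k) x)%C n
  = (6 * x * RtoC (INR n)
     * (lucas_balancing (2 * n - 2) x - r * balancing (2 * n - 2) x))%C.
Proof.
  (* This also holds for [n = 0], where both truncated differences are 0. *)
  replace (2 * n - 2)%nat with (2 * (n - 1))%nat by lia.
  rewrite (proj2 (lucas_balancing_balancing_pow x r hr _)), Cpow_mult_r.
  destruct (Ceq_dec r 0) as [Hr|Hr].
  - subst r.
    assert (hx : (9 * x ^ 2 = 1)%C).
    { transitivity (9 * x ^ 2 - 1 + 1)%C; [ring|rewrite <- hr; ring]. }
    replace ((3 * x - 0) ^ 2)%C with (RtoC 1) by (rewrite <- hx; ring).
    rewrite Cpow_1_l.
    destruct n as [|n].
    + rewrite sum_O; simpl; Cring.
    + rewrite sum_n_C_Sn, (sum_n_ext_loc (G := C_AbelianMonoid) _ (fun _ => 0 * 0)%C n).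
      * rewrite sum_n_C_mult_l, Nat.sub_diag, C_n_n, (bernoulli_0 B hB).
        rewrite (balancing_even_of_sq_eq x hx).
        simpl Cpow; Cring.
      * intros k Hk; replace (S n - k)%nat with (S (n - k)) by lia.
        rewrite Cpow_S; Cring.
  - assert (hk : forall k, balancing (2 * k) x
        = (/ (2 * r) * (((3 * x - r) ^ 2 + 12 * x * r) ^ k - ((3 * x - r) ^ 2) ^ k))%C).
    { intros k.
      replace ((3 * x - r) ^ 2 + 12 * x * r)%C with ((3 * x + r) ^ 2)%C by ring.
      rewrite <- !Cpow_mult_r.
      destruct (lucas_balancing_balancing_pow x r hr (2 * k)) as [<- <-].
      field; assumption. }
    set (y := ((3 * x - r) ^ 2)%C) in *.
    assert (hd := bernoulli_difference B hB (12 * x * r) y n).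
    set (S1 := sum_n _ _) in hd at 1. set (S0 := sum_n _ _) in hd.
    (* [S1] and [S0] are the homogenized polynomial at [y + D] and at [y]. Dividing the difference
       by [2r] turns the factor [12xr] into [6x]. *)
    transitivity (/ (2 * r) * (S1 + (-1) * S0))%C.
    + unfold S1, S0. rewrite <- sum_n_C_mult_l, <- sum_n_C_plus, <- sum_n_C_mult_l.
      apply sum_n_ext; intros k. rewrite hk; Cring.
    + rewrite hd. eq_in_C; field; assumption.
Qed.
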